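(* Let $\mathcal{G}$ be a linear nested sequent. If $\mathcal{G}$ has a non-wellfounded proof, i.e. $\mathsf{LNS^{\infty}_{LTL}} \Vdash \mathcal{G}$, then $\mathcal{G}$ is valid.
   Context: **Language and semantics.** Let $\mathsf{Atm}$ be a denumerable set of atoms. Formulae of $\mathscr{L}$ are given by $A,B ::= p \mid \bot \mid (A \to B) \mid \mathtt{X} A \mid (A \,\mathtt{U}\, B)$ with $p \in \mathsf{Atm}$; $\neg A := A \to \bot$, $A \lor B := \neg A \to B$, $A \land B := \neg(A \to \neg B)$. A state sequence is an infinite sequence $\bar\sigma = (\sigma_0,\sigma_1,\ldots)$ with each $\sigma_i \subseteq \mathsf{Atm}$. Satisfaction at $i \ge 0$: $\bar\sigma,i \vDash p$ iff $p \in \sigma_i$; $\bar\sigma,i\not\vDash\bot$; $\bar\sigma,i\vDash A\to B$ iff $\bar\sigma,i\not\vDash A$ or $\bar\sigma,i\vDash B$; $\bar\sigma,i\vDash \mathtt{X}A$ iff $\bar\sigma,i+1\vDash A$; $\bar\sigma,i\vDash A\,\mathtt{U}\,B$ iff there is $j\ge i$ with $\bar\sigma,j\vDash B$ and $\bar\sigma,n\vDash A$ for all $i\le n<j$. $\bar\sigma\vDash A$ means $\bar\sigma,0\vDash A$; $A$ is valid iff $\bar\sigma\vDash A$ for every state sequence $\bar\sigma$. **Linear nested sequents.** A Gentzen sequent is $\Gamma\vdash\Delta$ with $\Gamma,\Delta$ finite sets of formulae. A linear nested sequent (LNS) is a nonempty finite sequence $\mathcal{G} = \Gamma_0\vdash\Delta_0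 /\!/ \cdots /\!/ \Gamma_n\vdash\Delta_n$ of Gentzen sequents; $\Gamma_i\vdash\Delta_i$ is its $i$-component. Formula interpretation: $f(\Gamma\vdash\Delta) := \bigwedge\Gamma\to\bigvee\Delta$, $f(\Gamma\vdash\Delta /\!/ \mathcal{G}) := \bigwedge\Gamma\to(\bigvee\Delta\lor\mathtt{X}f(\mathcal{G}))$. $\bar\sigma,i\vDash\mathcal{G}$ iff $\bar\sigma,i\vDash f(\mathcal{G})$; $\mathcal{G}$ is valid iff $f(\mathcal{G})$ is valid. **Rules** ($\mathsf{LNS_{LTL}}$). Here $\mathcal{G},\mathcal{H}$ are possibly empty, and the comma is set union (so in ''$\Gamma, A$'' one may have $A\in\Gamma$). Initial rules (no premises): $\mathsf{id}$: $\mathcal{G}/\!/\Gamma,p\vdash p,\Delta/\!/\mathcal{H}$; $\bot\mathsf{L}$: $\mathcal{G}/\!/\Gamma,\bot\vdash\Delta/\!/\mathcal{H}$. Their conclusions are called initial sequents. Logical rules: - ${\to}\mathsf{R}$: from $\mathcal{G}/\!/\Gamma,A\vdash B,\Delta/\!/\mathcal{H}$ infer $\mathcal{G}/\!/\Gamma\vdash A\to B,\Delta/\!/\mathcal{H}$. - ${\to}\mathsf{L}$: from $\mathcal{G}/\!/\Gamma,B\vdash\Delta/\!/\mathcal{H}$ and $\mathcal{G}/\!/\Gamma\vdash A,\Delta/\!/\mathcal{H}$ infer $\mathcal{G}/\!/\Gamma,A\to B\vdash\Delta/\!/\mathcal{H}$. - $\mathtt{X}\mathsf{L}_1$: from $\mathcal{G}/\!/\Gamma\vdash\Delta/\!/\Sigma,A\vdash\Pi/\!/\mathcal{H}$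 infer $\mathcal{G}/\!/\Gamma,\mathtt{X}A\vdash\Delta/\!/\Sigma\vdash\Pi/\!/\mathcal{H}$. - $\mathtt{X}\mathsf{L}_2$: from $\mathcal{G}/\!/\Gamma\vdash\Delta/\!/A\vdash$ infer $\mathcal{G}/\!/\Gamma,\mathtt{X}A\vdash\Delta$. - $\mathtt{X}\mathsf{R}_1$: from $\mathcal{G}/\!/\Gamma\vdash\Delta/\!/\Sigma\vdash A,\Pi/\!/\mathcal{H}$ infer $\mathcal{G}/\!/\Gamma\vdash\mathtt{X}A,\Delta/\!/\Sigma\vdash\Pi/\!/\mathcal{H}$. - $\mathtt{X}\mathsf{R}_2$: from $\mathcal{G}/\!/\Gamma\vdash\Delta/\!/\vdash A$ infer $\mathcal{G}/\!/\Gamma\vdash\mathtt{X}A,\Delta$. - $\mathtt{U}\mathsf{L}_1$: from (left) $\mathcal{G}/\!/\Gamma,B\vdash\Delta/\!/\Sigma\vdash\Pi/\!/\mathcal{H}$ and (right) $\mathcal{G}/\!/\Gamma,A\vdash\Delta/\!/\Sigma,A\,\mathtt{U}\,B\vdash\Pi/\!/\mathcal{H}$ infer $\mathcal{G}/\!/\Gamma,A\,\mathtt{U}\,B\vdash\Delta/\!/\Sigma\vdash\Pi/\!/\mathcal{H}$. - $\mathtt{U}\mathsf{R}_1$: from (left) $\mathcal{G}/\!/\Gamma\vdash A,B,\Delta/\!/\Sigma\vdash\Pi/\!/\mathcal{H}$ and (right) $\mathcal{G}/\!/\Gamma\vdash B,\Delta/\!/\Sigma\vdash A\,\mathtt{U}\,B,\Pi/\!/\mathcal{H}$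 infer $\mathcal{G}/\!/\Gamma\vdash A\,\mathtt{U}\,B,\Delta/\!/\Sigma\vdash\Pi/\!/\mathcal{H}$. - $\mathtt{U}\mathsf{L}_2$: from (left) $\mathcal{G}/\!/\Gamma,B\vdash\Delta$ and (right) $\mathcal{G}/\!/\Gamma,A\vdash\Delta/\!/A\,\mathtt{U}\,B\vdash$ infer $\mathcal{G}/\!/\Gamma,A\,\mathtt{U}\,B\vdash\Delta$. - $\mathtt{U}\mathsf{R}_2$: from (left) $\mathcal{G}/\!/\Gamma\vdash A,B,\Delta$ and (right) $\mathcal{G}/\!/\Gamma\vdash B,\Delta/\!/\vdash A\,\mathtt{U}\,B$ infer $\mathcal{G}/\!/\Gamma\vdash A\,\mathtt{U}\,B,\Delta$. The principal formula of a logical rule is the (occurrence of the) formula explicitly displayed in its conclusion. **Derivations.** A derivation of $\mathcal{G}$ is a possibly infinite tree of LNSs with root $\mathcal{G}$ in which every parent node is the conclusion of a rule whose premises are its children. A path is a finite or infinite sequence of nodes in which each is the parent of the next; a branch is a maximal path starting at the root. **Traces and non-wellfounded proofs.** A trace value of $\mathcal{G}=\Gamma_0\vdash\Delta_0/\!/\cdots/\!/\Gamma_n\vdash\Delta_n$ is a pair $\langle A\,\mathtt{U}\,B,i\rangle$ with $0\le i\le n$ and $A\,\mathtt{U}\,B\in\Gamma_i$. For a rule instance $\mathsf{r}$ with conclusion $\mathcal{G}$ and premise $\mathcal{H}$, $(\langle A\,\mathtt{U}\,B,i\rangle,\langle A\,\mathtt{U}\,B,j\rangle)$ is a trace pair for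 $(\mathcal{G},\mathcal{H})$ iff these are trace values of $\mathcal{G}$ and $\mathcal{H}$ respectively and (1) if $A\,\mathtt{U}\,B$ is not principal in $\mathsf{r}$, then $i=j$; (2) if $A\,\mathtt{U}\,B$ is principal in $\mathsf{r}$, then $j=i+1$ and $\mathcal{H}$ is the right premise of $\mathsf{r}$. It is progressing iff $j=i+1$. A trace along a path $\{\mathcal{G}_i\}_{i}$ is a sequence of trace values $\{\tau_i\}_i$ such that each $(\tau_i,\tau_{i+1})$ is a trace pair for $(\mathcal{G}_i,\mathcal{G}_{i+1})$. A trace along an infinite path is progressing iff infinitely many of its trace pairs are progressing; an infinite path is progressing iff it has a progressing trace. A non-wellfounded proof ($\mathsf{LNS^{\infty}_{LTL}}$-proof) of $\mathcal{G}$ is a derivation of $\mathcal{G}$ in which every leaf is an initial sequent and every infinite branch has a suffix that is a progressing path. $\mathsf{LNS^{\infty}_{LTL}}\Vdash\mathcal{G}$ means such a proof exists. *)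

(* Defs.v *)
From HB Require Import structures.
From mathcomp Require Import all_boot finmap classical_sets.

Set Implicit Arguments.
Unset Strict Implicit.
Unset Printing Implicit Defensive.

Local Open Scope fset_scope.
Local Open Scope nat_scope.

Inductive form (Atm : Type) : Type :=
| Atom of Atm
| Bot
| Imp of form Atm & form Atm
| Next of form Atm
| Until of form Atm & form Atm.

Arguments Bot {Atm}.

Definition Neg (Atm : Type) (A : form Atm) := Imp A Bot.
Definition Or (Atm : Type) (A B : form Atm) := Imp (Neg A) B.
Definition And (Atm : Type) (A B : form Atm) := Neg (Imp A (Neg B)).
Definition Top (Atm : Type) : form Atm := Neg Bot.

(* [form Atm] is a choiceType, as {fset form Atm} requires. *)
Fixpoint form_encode (Atm : Type) (A : form Atm) : GenTree.tree Atm :=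
  match A with
  | Atom p => GenTree.Leaf p
  | Bot => GenTree.Node 0 [::]
  | Imp A B => GenTree.Node 1 [:: form_encode A; form_encode B]
  | Next A => GenTree.Node 2 [:: form_encode A]
  | Until A B => GenTree.Node 3 [:: form_encode A; form_encode B]
  end.

Fixpoint form_decode (Atm : Type) (t : GenTree.tree Atm) : option (form Atm) :=
  match t with
  | GenTree.Leaf p => Some (Atom p)
  | GenTree.Node 0 [::] => Some Bot
  | GenTree.Node 1 [:: t1; t2] =>
      match form_decode t1, form_decode t2 with
      | Some A, Some B => Some (Imp A B)
      | _, _ => None
      end
  | GenTree.Node 2 [:: t1] => omap (@Next Atm) (form_decode t1)
  | GenTree.Node 3 [:: t1; t2] =>
      match form_decode t1, form_decode t2 with
      | Some A, Some B => Some (Until A B)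
      | _, _ => None
      end
  | _ => None
  end.

Lemma form_encodeK (Atm : Type) :
  pcancel (@form_encode Atm) (@form_decode Atm).
Proof. by elim=> [p||A IHA B IHB|A IHA|A IHA B IHB] //=; rewrite IHA ?IHB. Qed.

HB.instance Definition _ (Atm : choiceType) :=
  Choice.copy (form Atm) (pcan_type (@form_encodeK Atm)).

Definition state_seq (Atm : Type) := nat -> set Atm.

Fixpoint sat (Atm : Type) (s : state_seq Atm) (i : nat) (A : form Atm) : Prop :=
  match A with
  | Atom p => s i p
  | Bot => False
  | Imp A B => ~ sat s i A \/ sat s i B
  | Next A => sat s i.+1 A
  | Until A B => exists j, [/\ i <= j, sat s j B &
                   forall n, i <= n -> n < j -> sat s n A]
  end.

Definition valid_form (Atm : Type) (A : form Atm) : Prop :=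
  forall s : state_seq Atm, sat s 0 A.

(* (Gam, Del) stands for the Gentzen sequent Gam |- Del. *)
Definition sequent (Atm : choiceType) : Type :=
  ({fset form Atm} * {fset form Atm})%type.

(* A nonempty list of sequents, as the 0-component and the remaining ones. *)
Record lns (Atm : choiceType) : Type := Lns {
  lns_head : sequent Atm;
  lns_tail : seq (sequent Atm) }.

Definition components (Atm : choiceType) (G : lns Atm) : seq (sequent Atm) :=
  lns_head G :: lns_tail G.

(* lns_at G S H is G // S // H, with G and H possibly empty; the displayed
   sequent S is its (size G)-component. *)
Definition lns_at (Atm : choiceType) (G : seq (sequent Atm)) (S : sequent Atm)
    (H : seq (sequent Atm)) : lns Atm :=
  match G with
  | [::] => Lns S H
  | T :: G' => Lns T (G' ++ S :: H)
  end.

Lemma components_lns_at (Atm : choiceType) (G : seq (sequent Atm))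
    (S : sequent Atm) (H : seq (sequent Atm)) :
  components (lns_at G S H) = G ++ S :: H.
Proof. by case: G. Qed.

(* The empty conjunction is Top and the empty disjunction is Bot; a finite set
   is enumerated in the order fixed by finmap. *)
Definition bigAnd (Atm : choiceType) (Gam : {fset form Atm}) : form Atm :=
  \big[@And Atm / Top Atm]_(A <- Gam) A.
Definition bigOr (Atm : choiceType) (Del : {fset form Atm}) : form Atm :=
  \big[@Or Atm / Bot]_(A <- Del) A.

Fixpoint interp_rec (Atm : choiceType) (S : sequent Atm)
    (H : seq (sequent Atm)) : form Atm :=
  match H with
  | [::] => Imp (bigAnd S.1) (bigOr S.2)
  | T :: H' => Imp (bigAnd S.1) (Or (bigOr S.2) (Next (interp_rec T H')))
  end.

Definition interp (Atm : choiceType) (G : lns Atm) : form Atm :=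
  interp_rec (lns_head G) (lns_tail G).

Definition valid_lns (Atm : choiceType) (G : lns Atm) : Prop :=
  valid_form (interp G).

Inductive initial (Atm : choiceType) : lns Atm -> Prop :=
| InitId G H Gam Del p :
    initial (lns_at G (Atom p |` Gam, Atom p |` Del) H)
| InitBotL G H Gam Del :
    initial (lns_at G (Bot |` Gam, Del) H).

Inductive side := Ant | Suc.

(* An occurrence of a formula in an LNS: the index of a component, a side of
   that component, and a formula standing there. *)
Definition occurrence (Atm : Type) : Type := (nat * side * form Atm)%type.

(* rule o C Ps: C is the conclusion and Ps the list of premises, from left to
   right, of an instance of a logical rule with principal formula occurrence
   o.  The sets Gam, Del, ... may already contain the displayed formulae. *)
Inductive rule (Atm : choiceType) :
    occurrence Atm -> lns Atm -> seq (lns Atm) -> Prop :=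
| ImpR G H Gam Del A B :
    rule (size G, Suc, Imp A B)
      (lns_at G (Gam, Imp A B |` Del) H)
      [:: lns_at G (A |` Gam, B |` Del) H]
| ImpL G H Gam Del A B :
    rule (size G, Ant, Imp A B)
      (lns_at G (Imp A B |` Gam, Del) H)
      [:: lns_at G (B |` Gam, Del) H;
          lns_at G (Gam, A |` Del) H]
| NextL1 G H Gam Del Sig Pi A :
    rule (size G, Ant, Next A)
      (lns_at G (Next A |` Gam, Del) ((Sig, Pi) :: H))
      [:: lns_at G (Gam, Del) ((A |` Sig, Pi) :: H)]
| NextL2 G Gam Del A :
    rule (size G, Ant, Next A)
      (lns_at G (Next A |` Gam, Del) [::])
      [:: lns_at G (Gam, Del) [:: ([fset A], fset0)]]
| NextR1 G H Gam Del Sig Pi A :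
    rule (size G, Suc, Next A)
      (lns_at G (Gam, Next A |` Del) ((Sig, Pi) :: H))
      [:: lns_at G (Gam, Del) ((Sig, A |` Pi) :: H)]
| NextR2 G Gam Del A :
    rule (size G, Suc, Next A)
      (lns_at G (Gam, Next A |` Del) [::])
      [:: lns_at G (Gam, Del) [:: (fset0, [fset A])]]
| UntilL1 G H Gam Del Sig Pi A B :
    rule (size G, Ant, Until A B)
      (lns_at G (Until A B |` Gam, Del) ((Sig, Pi) :: H))
      [:: lns_at G (B |` Gam, Del) ((Sig, Pi) :: H);
          lns_at G (A |` Gam, Del) ((Until A B |` Sig, Pi) :: H)]
| UntilR1 G H Gam Del Sig Pi A B :
    rule (size G, Suc, Until A B)
      (lns_at G (Gam, Until A B |` Del) ((Sig, Pi) :: H))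
      [:: lns_at G (Gam, A |` (B |` Del)) ((Sig, Pi) :: H);
          lns_at G (Gam, B |` Del) ((Sig, Until A B |` Pi) :: H)]
| UntilL2 G Gam Del A B :
    rule (size G, Ant, Until A B)
      (lns_at G (Until A B |` Gam, Del) [::])
      [:: lns_at G (B |` Gam, Del) [::];
          lns_at G (A |` Gam, Del) [:: ([fset Until A B], fset0)]]
| UntilR2 G Gam Del A B :
    rule (size G, Suc, Until A B)
      (lns_at G (Gam, Until A B |` Del) [::])
      [:: lns_at G (Gam, A |` (B |` Del)) [::];
          lns_at G (Gam, B |` Del) [:: (fset0, [fset Until A B])]].

(* A node is an address: the root is [::] and the i-th child of v is
   rcons v i. *)
Definition node : Type := seq nat.

(* label v is None when v is not a node of the tree.  principal v is the
   principal occurrence of the rule applied at v; it is irrelevant when v is a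
   leaf or not in the tree. *)
Record ptree (Atm : choiceType) : Type := PTree {
  label : node -> option (lns Atm);
  principal : node -> occurrence Atm }.

Definition leaf (Atm : choiceType) (D : ptree Atm) (v : node) : Prop :=
  label D v <> None /\ forall i, label D (rcons v i) = None.

Definition derivation (Atm : choiceType) (D : ptree Atm) (G : lns Atm) : Prop :=
  [/\ label D [::] = Some G,
      forall v, label D v = None -> forall i, label D (rcons v i) = None &
      forall v C, label D v = Some C -> ~ leaf D v ->
        exists Ps, rule (principal D v) C Ps /\
          forall i, label D (rcons v i) = onth Ps i].

Definition infinite_path (Atm : choiceType) (D : ptree Atm)
    (b : nat -> node) : Prop :=
  forall n, label D (b n) <> None /\ exists i, b n.+1 = rcons (b n) i.

(* An infinite path is maximal as soon as it starts at the root. *)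
Definition infinite_branch (Atm : choiceType) (D : ptree Atm)
    (b : nat -> node) : Prop :=
  b 0 = [::] /\ infinite_path D b.

(* ((A, B), i) stands for the trace value < A U B, i >. *)
Definition tval (Atm : Type) : Type := (form Atm * form Atm * nat)%type.

Definition tform (Atm : Type) (t : tval Atm) : form Atm := Until t.1.1 t.1.2.

Definition trace_value (Atm : choiceType) (G : lns Atm) (t : tval Atm) : Prop :=
  t.2 < size (components G) /\
  tform t \in (nth (fset0, fset0) (components G) t.2).1.

(* o is the principal occurrence of a rule instance with conclusion C, and P
   is its k-th premise; k = 1 for the right premise. *)
Definition trace_pair (Atm : choiceType) (o : occurrence Atm) (C : lns Atm)
    (k : nat) (P : lns Atm) (t u : tval Atm) : Prop :=
  [/\ trace_value C t,
      trace_value P u,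
      tform u = tform t,
      o <> (t.2, Ant, tform t) -> t.2 = u.2 &
      o = (t.2, Ant, tform t) -> u.2 = t.2.+1 /\ k = 1].

Definition progressing_pair (Atm : Type) (t u : tval Atm) : Prop :=
  u.2 = t.2.+1.

Definition trace_along (Atm : choiceType) (D : ptree Atm) (b : nat -> node)
    (tau : nat -> tval Atm) : Prop :=
  forall n, exists C k P,
    [/\ label D (b n) = Some C,
        b n.+1 = rcons (b n) k,
        label D (b n.+1) = Some P &
        trace_pair (principal D (b n)) C k P (tau n) (tau n.+1)].

Definition progressing_trace (Atm : Type) (tau : nat -> tval Atm) : Prop :=
  forall N, exists2 n, N <= n & progressing_pair (tau n) (tau n.+1).

Definition progressing_path (Atm : choiceType) (D : ptree Atm)
    (b : nat -> node) : Prop :=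
  exists tau, trace_along D b tau /\ progressing_trace tau.

Definition nonwf_proof (Atm : choiceType) (D : ptree Atm) (G : lns Atm) : Prop :=
  [/\ derivation D G,
      forall v C, label D v = Some C -> leaf D v -> initial C &
      forall b, infinite_branch D b ->
        exists m, progressing_path D (fun n => b (m + n))].

Definition nonwf_provable (Atm : choiceType) (G : lns Atm) : Prop :=
  exists D, nonwf_proof D G.

Definition denumerable (T : Type) : Prop :=
  exists f : nat -> T, bijective f.

(* Main.v *)
(** A state sequence refuting the conclusion of a rule refutes one of its
    premises, and for U-left rules on [A U B] at component [i] the right premise
    is needed only when [B] fails at [i].  A refutation of the root thus yields
    an infinite branch of refuted sequents.  Along a trace on that branch,
    [A U B] holds at the initial index, hence [B] holds at some later [j]; the
    index of the trace advances only past points where [B] fails, so it never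
    exceeds [j] and the trace progresses only finitely often. *)
Require Import Defs.
From mathcomp Require Import all_boot.
From mathcomp Require Import finmap boolp.

Set Implicit Arguments.
Unset Strict Implicit.
Unset Printing Implicit Defensive.

Local Open Scope fset_scope.
Local Open Scope nat_scope.

Lemma sat_ImpE (Atm : Type) (s : state_seq Atm) i (A B : form Atm) :
  sat s i (Imp A B) = (sat s i A -> sat s i B).
Proof.
apply/propext; split=> [/= [nA|sB] // | AB /=].
by case: (EM (sat s i A)) => [/AB|]; [right|left].
Qed.

Lemma sat_OrE (Atm : Type) (s : state_seq Atm) i (A B : form Atm) :
  sat s i (Or A B) = (sat s i A \/ sat s i B).
Proof.
rewrite /Or /Neg !sat_ImpE; apply/propext; split=> [AB|[sA /(_ sA)|]] //.
by case: (EM (sat s i A)); [left|right; apply: AB].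
Qed.

Lemma sat_AndE (Atm : Type) (s : state_seq Atm) i (A B : form Atm) :
  sat s i (And A B) = (sat s i A /\ sat s i B).
Proof.
rewrite /And /Neg !sat_ImpE; apply/propext; split=> [nAB|[sA sB] nAB]; last first.
  exact: nAB.
by split; apply: contrapT => nS; apply: nAB.
Qed.

Section Refutation.
Variables (Atm : choiceType) (s : state_seq Atm).
Implicit Types (A B : form Atm) (Gam Del : {fset form Atm}) (S : sequent Atm)
  (H : seq (sequent Atm)).

Lemma sat_bigAnd i Gam :
  sat s i (bigAnd Gam) -> forall A, A \in Gam -> sat s i A.
Proof.
rewrite /bigAnd => + A; have -> : A \in Gam = (A \in enum_fset Gam) by [].
elim: (enum_fset Gam) => [//|B l IH]; rewrite big_cons sat_AndE inE.
by move=> [sB /IH sl] /orP[/eqP->|].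
Qed.

Lemma sat_bigOr i Del A : A \in Del -> sat s i A -> sat s i (bigOr Del).
Proof.
rewrite /bigOr; have -> : A \in Del = (A \in enum_fset Del) by [].
elim: (enum_fset Del) => [//|B l IH]; rewrite big_cons sat_OrE inE.
by move=> /orP[/eqP->|Al sA]; [left|right; apply: IH].
Qed.

Definition refutes_sequent i S : Prop :=
  (forall A, A \in S.1 -> sat s i A) /\ (forall A, A \in S.2 -> ~ sat s i A).

(** The negated formula interpretation as a plain conjunction: component [k] is refuted at time
    [i + k]. The empty list counts as refuted, so that contexts split off by concatenation. *)
Fixpoint refutes i H : Prop :=
  if H is T :: H' then refutes_sequent i T /\ refutes i.+1 H' else True.

Lemma refutes_sequent0 i : refutes_sequent i (fset0, fset0) = True.
Proof. by apply/propext; split=> // _; split=> A; rewrite inE. Qed.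

Lemma refutes_sequentL i A Gam Del :
  refutes_sequent i (A |` Gam, Del) =
  (sat s i A /\ refutes_sequent i (Gam, Del)).
Proof.
apply/propext; split=> [[/= L R]|[sA [/= L R]]].
  split; first by apply: L; rewrite fset1U1.
  by split=> // B BG; apply: L; rewrite fset1Ur.
by split=> //= B; rewrite in_fset1U => /orP[/eqP->|/L].
Qed.

Lemma refutes_sequentR i A Gam Del :
  refutes_sequent i (Gam, A |` Del) =
  (~ sat s i A /\ refutes_sequent i (Gam, Del)).
Proof.
apply/propext; split=> [[/= L R]|[sA [/= L R]]].
  split; first by apply: R; rewrite fset1U1.
  by split=> // B BG; apply: R; rewrite fset1Ur.
by split=> //= B; rewrite in_fset1U => /orP[/eqP->|/R].
Qed.

Lemma refutes_sequent1L i A :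
  refutes_sequent i ([fset A], fset0) = sat s i A.
Proof.
rewrite -[[fset A]]fsetU0 refutes_sequentL refutes_sequent0.
by apply/propext; split=> [[]|].
Qed.

Lemma refutes_sequent1R i A :
  refutes_sequent i (fset0, [fset A]) = (~ sat s i A).
Proof.
rewrite -[[fset A]]fsetU0 refutes_sequentR refutes_sequent0.
by apply/propext; split=> [[]|].
Qed.

Lemma refutes_cat i H1 H2 :
  refutes i (H1 ++ H2) = (refutes i H1 /\ refutes (i + size H1) H2).
Proof.
elim: H1 i => [|S H1 IH] i /=.
  by rewrite addn0; apply/propext; split=> [|[]].
by rewrite IH addSnnS; apply/propext; split=> [[? []]|[[]]].
Qed.

Lemma refutes_nth i H k S0 :
  refutes i H -> k < size H -> refutes_sequent (i + k) (nth S0 H k).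
Proof.
elim: H i k => [//|S H IH] i [|k] /= [rS rH]; first by rewrite addn0.
by rewrite ltnS addnS -addSn; apply: IH.
Qed.

Lemma interp_rec_refutes i S H :
  ~ sat s i (interp_rec S H) -> refutes i (S :: H).
Proof.
have imp k A B : ~ sat s k (Imp A B) -> sat s k A /\ ~ sat s k B.
  by rewrite sat_ImpE => /not_implyP.
elim: H i S => [|T H IH] i S /imp[/sat_bigAnd L].
  by move=> R; split=> //; split=> // A AD sA; apply: R; apply: sat_bigOr sA.
rewrite sat_OrE => /not_orP[R nX]; split; last exact: IH.
by split=> // A AD sA; apply: R; apply: sat_bigOr sA.
Qed.

(** The one-step unfolding of U behind the four U rules: the witness is [i] itself or lies later. *)
Lemma sat_UntilE i A B :
  sat s i (Until A B) = (sat s i B \/ sat s i A /\ sat s i.+1 (Until A B)).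
Proof.
apply/propext; split=> [[j [ij sB sA]]|[sB|[sA [j [ij sB sA']]]]].
- move: ij; rewrite leq_eqVlt => /predU1P[->|ij]; first by left.
  right; split; first exact: sA.
  by exists j; split=> // n /ltnW; apply: sA.
- by exists i; split=> // n /leq_ltn_trans/[apply]; rewrite ltnn.
- exists j; split=> // [|n]; first exact: ltnW.
  by rewrite leq_eqVlt => /predU1P[<- //|]; apply: sA'.
Qed.

Lemma initial_not_refutes (G : lns Atm) :
  initial G -> ~ refutes 0 (components G).
Proof.
by case=> [G0 H Gam Del p|G0 H Gam Del];
  rewrite components_lns_at refutes_cat /= ?refutes_sequentL ?refutes_sequentR;
  tauto.
Qed.

(** The last clause serves the traces: they pass a principal U formula only into premise 1. Since
    the root is read at time 0, the component index [i] is also the time at which [B] fails. *)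
Lemma rule_refutes o (C : lns Atm) Ps :
  rule o C Ps -> refutes 0 (components C) ->
  exists k P, [/\ onth Ps k = Some P, refutes 0 (components P) &
    forall i A B, o = (i, Ant, Until A B) -> k = 1 -> ~ sat s i B].
Proof.
pose refutesE :=
  (components_lns_at, refutes_cat, refutes_sequent1L, refutes_sequent1R).
pose seqE := (refutes_sequentL, refutes_sequentR).
case=> [G H Gam Del A B|G H Gam Del A B|G H Gam Del Sig Pi A|G Gam Del A
  |G H Gam Del Sig Pi A|G Gam Del A|G H Gam Del Sig Pi A B|G H Gam Del Sig Pi A B
  |G Gam Del A B|G Gam Del A B];
  rewrite !refutesE [refutes _ (_ :: _)]/= add0n ?seqE => -[rG hyps].
- have [[/[!sat_ImpE]/not_implyP[sA nB] rS] rH] := hyps.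
  by exists 0; eexists; split=> //; rewrite !refutesE /= add0n !seqE.
- have [[/[!sat_ImpE] AB rS] rH] := hyps.
  case: (EM (sat s (size G) B)) => [sB|nB].
    by exists 0; eexists; split=> //; rewrite !refutesE /= add0n !seqE.
  exists 1; eexists; split=> //; rewrite !refutesE /= add0n !seqE.
  by split=> //; split=> //; split=> // /AB.
- exists 0; eexists; split=> //; rewrite !refutesE /= add0n !seqE.
  by move: hyps => /=; tauto.
- exists 0; eexists; split=> //; rewrite !refutesE /= add0n !refutesE.
  by move: hyps => /=; tauto.
- exists 0; eexists; split=> //; rewrite !refutesE /= add0n !seqE.
  by move: hyps => /=; tauto.
- exists 0; eexists; split=> //; rewrite !refutesE /= add0n !refutesE.
  by move: hyps => /=; tauto.
- have [[sU rS] rH] := hyps; rewrite sat_UntilE in sU.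
  (* The left premise is preferred whenever [B] holds, even if the right one is refuted too, so that
     choosing the right one certifies that [B] fails. *)
  case: (EM (sat s (size G) B)) => [sB|nB].
    by exists 0; eexists; split=> //; rewrite !refutesE /= add0n !seqE.
  exists 1; eexists; split=> // [|i A' B' [<- _ <-]] //.
  rewrite !refutesE [refutes _ (_ :: _)]/= add0n !seqE.
  by case: sU => // -[sA sU]; tauto.
- have [[+ rS] rH] := hyps; rewrite sat_UntilE => /not_orP[nB nU].
  (* [B] fails in both cases; if [A] holds, then by [nU] the U formula fails at the next time. *)
  case: (EM (sat s (size G) A)) => [sA|nA]; last first.
    by exists 0; eexists; split=> //; rewrite !refutesE /= add0n !seqE.
  exists 1; eexists; split=> //.
  by rewrite !refutesE [refutes _ (_ :: _)]/= add0n !seqE; tauto.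
- have [[sU rS] rH] := hyps; rewrite sat_UntilE in sU.
  case: (EM (sat s (size G) B)) => [sB|nB].
    by exists 0; eexists; split=> //; rewrite !refutesE /= add0n !seqE.
  exists 1; eexists; split=> // [|i A' B' [<- _ <-]] //.
  rewrite !refutesE [refutes _ (_ :: _)]/= add0n !seqE !refutesE.
  by case: sU => // -[sA sU]; tauto.
- have [[+ rS] rH] := hyps; rewrite sat_UntilE => /not_orP[nB nU].
  case: (EM (sat s (size G) A)) => [sA|nA]; last first.
    by exists 0; eexists; split=> //; rewrite !refutesE /= add0n !seqE.
  exists 1; eexists; split=> //.
  by rewrite !refutesE [refutes _ (_ :: _)]/= add0n !seqE !refutesE; tauto.
Qed.

Definition refuted_node (D : ptree Atm) v : Prop :=
  exists2 C, label D v = Some C & refutes 0 (components C).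

Definition refuting_step (D : ptree Atm) v w : Prop :=
  exists2 k, w = rcons v k &
    forall i A B, principal D v = (i, Ant, Until A B) -> k = 1 -> ~ sat s i B.

Lemma refuted_branch (D : ptree Atm) (G : lns Atm) :
  nonwf_proof D G -> refutes 0 (components G) ->
  exists2 b, infinite_branch D b &
    forall n, refuted_node D (b n) /\ refuting_step D (b n) (b n.+1).
Proof.
move=> [[root _ step] leaves _] rG.
(* Stated for every address, with a dummy successor off the refuted nodes, so that [choice] yields a
   total function to iterate from the root. *)
have next v : exists w, refuted_node D v ->
    refuted_node D w /\ refuting_step D v w.
  case: (EM (refuted_node D v)) => [[C vC rC]|nv]; last by exists v.
  have [//|Ps [r DPs]] := step _ _ vC.
    by move=> /(leaves _ _ vC)/initial_not_refutes.
  have [k [P [PsP rP nB]]] := rule_refutes r rC.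
  exists (rcons v k) => _; split; last by exists k.
  by exists P => //; rewrite DPs.
have [f fP] := choice next.
have bP n : refuted_node D (iter n f [::]).
  elim: n => [|n IH]; first by exists G.
  by have [] := fP _ IH.
exists (fun n => iter n f [::]) => [|n]; last first.
  by split=> //; have [] := fP _ (bP n).
split=> // n; split; first by have [C ->] := bP n.
by have [_ [k ? _]] := fP _ (bP n); exists k.
Qed.

(** The path need not start at the root, so the result applies to suffixes of a branch. *)
Lemma refuted_path_not_progressing (D : ptree Atm) b :
  (forall n, refuted_node D (b n) /\ refuting_step D (b n) (b n.+1)) ->
  ~ progressing_path D b.
Proof.
move=> bP [tau [along prog]].
(* The first trace value stands in a refuted antecedent, so its U formula holds there; [j] is its
   witness. *)
have [j [le0j sB]] : exists j, (tau 0).2 <= j /\ sat s j (tau 0).1.2.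
  have [C [k [P [b0 _ _ [[lt in0] _ _ _ _]]]]] := along 0.
  have [[C' ]] := bP 0; rewrite b0 => -[<-] rC _.
  have [/(_ _ in0) + _] := refutes_nth (fset0, fset0) rC lt.
  by rewrite add0n => -[j [le sB _]]; exists j.
(* The U formula never changes along the trace, so the single [j] bounds all its indices. *)
have bound n : (tau n).1 = (tau 0).1 /\ (tau n).2 <= j.
  elim: n => [//|n [eqn len]].
  have [C [k [P [_ bS _ [_ _ eqU same next]]]]] := along n.
  have eqS : (tau n.+1).1 = (tau n).1.
    by case: eqU; case: (tau n.+1).1 (tau n).1 => [? ?] [? ?] /= -> ->.
  split; first by rewrite eqS.
  have [/[dup] prin /next[-> k1]|/same <- //] :=
    EM (principal D (b n) = ((tau n).2, Ant, tform (tau n))).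
  have [_ [k' bS' nB]] := bP n.
  have k'1 : k' = 1 by move: bS'; rewrite bS k1 => /rcons_inj[].
  (* An advance from index [j] itself would require [B] to fail at [j], against [sB]. *)
  rewrite ltn_neqAle len andbT; apply/eqP => eqj.
  by apply: (nB _ _ _ prin k'1); rewrite eqj eqn.
have mono n : (tau n).2 <= (tau n.+1).2.
  have [C [k [P [_ _ _ [_ _ _ same next]]]]] := along n.
  by have [/next[->]|/same->] :=
    EM (principal D (b n) = ((tau n).2, Ant, tform (tau n))).
(* Each of the infinitely many progressing pairs adds one to the index, and by [mono] no step lowers
   it. *)
have unbounded N : exists n, N <= (tau n).2.
  elim: N => [|N [n leN]]; first by exists 0.
  have [m lenm pm] := prog n; exists m.+1.
  by rewrite pm ltnS (leq_trans leN) // (homo_leq (@leqnn) leq_trans mono).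
have [n] := unbounded j.+1.
by rewrite ltnNge (bound n).2.
Qed.

End Refutation.

Theorem theorem4p1 (Atm : choiceType) (hAtm : denumerable Atm) (G : lns Atm) :
  nonwf_provable G -> valid_lns G.
Proof.
move=> [D prf] s; apply: contrapT => /interp_rec_refutes rG.
have [b branch bP] := refuted_branch prf rG.
have [_ _ /(_ b branch) [m]] := prf.
(* The conditions in [bP] concern single steps, so the suffix from [m] inherits them. *)
by apply: (refuted_path_not_progressing (s := s)) => n; rewrite addnS.
Qed.
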